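(* Every game of length $L=17{,}697$ has $$K=118,\qquad S=3,\qquad \delta_i=0\quad(1\le i\le 118),$$ and $$f=8,\qquad P=96,\qquad C_{\mathrm p}=8,\qquad C+T=30.$$ Thus all sixteen pawns make six one-rank pawn moves, promoting on the sixth; at least $29$ captures occur; and every segment has the maximum length permitted by its endpoint parity (that is, length $150$ if its two endpoints have the same colour and length $149$ if they have different colours). The critical-move block pattern and the endpoint block pattern are both $\mathtt{BWBW}$.
   Context: Game. Legal moves are those of standard chess (including the initial two-rank pawn advance, en passant, compulsory promotion, and castling, which counts as one move). One ply is one move by one player; White plays the odd-numbered plies. A game is a sequence of legal moves from the standard initial position, continued until the first mandatory termination condition of the FIDE Laws effective from 1 January 2023 applies; $L$ is its number of plies. The mandatory conditions are: (1) checkmate, stalemate, or a dead position (one from which neither player can checkmate by any possible sequence of legal moves); (2) fivefold repetition: the same position (same player to move, same kinds and colours of pieces on the same squares, same possible moves of all pieces of both players, so en passant availability and castling rights matter) has appeared at least five times; (3) the seventy-five-move rule: 150 consecutive plies without a pawn move or a capture (if the final ply delivers checkmate, checkmate takes precedence). Time forfeiture, resignation, draws by agreement and claimable draws are disregarded. Pieces. ''Piece'' includes pawns. The 32 initial pieces are followed through the game, retaining their identity after promotion; after promotion a piece is no longer a pawn, but it remains one of the pieces that began as pawns. ''All sixteen pawns'' are the sixteen pieces that began as pawns. A pawn move is a move of a piece while it is still a pawn (a promotion move is a pawn move). Segments. A critical move is a pawn move or a capture; every other move (including castling) is noncritical. Let $t_1<\dots<t_m$ be the plies on which critical moves occur.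 Set $T=1$ if at least one noncritical ply follows the last critical move, or if the game contains no critical move, and $T=0$ otherwise. Put $e_0=0$, $e_i=t_i$ for $1\le i\le m$ and, when $T=1$, $e_{m+1}=L$. The number of segments is $K=m+T$, segment $i$ being the set of plies $\{e_{i-1}+1,\dots,e_i\}$ ($1\le i\le K$), with endpoints $e_{i-1}$ and $e_i$ and length $e_i-e_{i-1}$. Switch count and shortfalls. For $i\ge1$, $\operatorname{col}(e_i)$ is the colour of the player who moves on ply $e_i$ (White if $e_i$ is odd, Black if even); the virtual endpoint $e_0=0$ is assigned the colour Black. The switch count is $S=\#\{i\in\{1,\dots,K\}:\operatorname{col}(e_i)\ne\operatorname{col}(e_{i-1})\}$. The shortfall $\delta_i$ of segment $i$ is $150-(e_i-e_{i-1})$ if $\operatorname{col}(e_i)=\operatorname{col}(e_{i-1})$, and $149-(e_i-e_{i-1})$ otherwise. Counts. $P$ is the number of pawn moves in the game, $C$ the number of captures, and $C_{\mathrm p}$ the number of captures made by pawns (by a piece while still a pawn; a capture made on the promotion move counts). Origin pairs. For each file, the White pawn and the Black pawn that begin on that file form its origin pair. An origin pair is resolved if at least one of its members makes a capture while still a pawn (a capture on the promotion move counts; a capture made by the promoted piece on a later move does not), and unresolved otherwise. $f$ is the number of resolved origin pairs. Block patterns. The block pattern of a nonempty finite sequence with entries in $\{\mathtt{B},\mathtt{W}\}$ (Black, White) is obtained by replacing each maximal constant run (block) by a single letter, e.g. $(\mathtt B,\mathtt B,\mathtt W,\mathtt W,\mathtt B)\mapsto\mathtt{BWB}$. The critical-move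 block pattern is that of $(\operatorname{col}(t_1),\dots,\operatorname{col}(t_m))$; the endpoint block pattern is that of $(\operatorname{col}(e_1),\dots,\operatorname{col}(e_K))$ (the virtual endpoint $e_0$ is not included). *)

(* Defs.v *)
From HB Require Import structures.
From mathcomp Require Import all_boot ssralg ssrint.

Set Implicit Arguments.
Unset Strict Implicit.
Unset Printing Implicit Defensive.

Import IntDist.

(** * Pieces and squares *)

Inductive color := White | Black.

Definition bool_of_color c := if c is White then true else false.
Definition color_of_bool b := if b then White else Black.
Lemma bool_of_colorK : cancel bool_of_color color_of_bool.
Proof. by case. Qed.
HB.instance Definition _ := Finite.copy color (can_type bool_of_colorK).

Definition opp c := if c is White then Black else White.

Inductive kind := King | Queen | Rook | Bishop | Knight | Pawn.

Definition kinds := [:: King; Queen; Rook; Bishop; Knight; Pawn].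
Definition nat_of_kind k :=
  match k with
  | King => 0 | Queen => 1 | Rook => 2 | Bishop => 3 | Knight => 4 | Pawn => 5
  end.
Lemma nat_of_kindK : cancel nat_of_kind (nth King kinds).
Proof. by case. Qed.
HB.instance Definition _ := Countable.copy kind (can_type nat_of_kindK).
Lemma kinds_enum : Finite.axiom kinds.
Proof. by case. Qed.
HB.instance Definition _ := isFinite.Build kind kinds_enum.

(* A square is a pair (file, rank): files a..h and ranks 1..8 are both
   numbered 0..7. *)
Definition square := ('I_8 * 'I_8)%type.

(* The identity of one of the 32 initial pieces, kept after promotion:
   (c, inl x) is the pawn of colour c beginning on file x, (c, inr x) the
   first-rank piece of colour c beginning on file x. *)
Definition piece := (color * ('I_8 + 'I_8))%type.

Notation ord8 n := (@Ordinal 8 n isT).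

Definition king c : piece := (c, inr (ord8 4)).

(* Rank of a square as seen by colour c; pawns of c move towards rank 7. *)
Definition rank_for c (q : square) : nat :=
  if c is White then q.2 : nat else 7 - q.2.

Definition home_rank c : 'I_8 := if c is White then ord8 0 else ord8 7.

(** * Positions *)

(* [kind_of] changes at promotion only; its value on a captured piece is
   irrelevant. [double_step] is the square reached by the pawn that has just
   advanced two ranks, if the previous ply was such an advance. *)
Record state := State {
  turn : color;
  board : square -> option piece;
  kind_of : piece -> kind;
  moved : piece -> bool;
  double_step : option square
}.

Definition initial : state := {|
  turn := White;
  board := fun q =>
    match nat_of_ord q.2 with
    | 0 => Some (White, inr q.1)
    | 1 => Some (White, inl q.1)
    | 6 => Some (Black, inl q.1)
    | 7 => Some (Black, inr q.1)
    | _ => None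
    end;
  kind_of := fun p =>
    match p.2 with
    | inl _ => Pawn
    | inr x =>
        nth King [:: Rook; Knight; Bishop; Queen; King; Bishop; Knight; Rook] x
    end;
  moved := fun _ => false;
  double_step := None
|}.

Definition empty (s : state) (q : square) : bool := board s q == None.

(** * Attacks *)

Definition file_dist (a b : square) : nat := `|(a.1 : nat) - (b.1 : nat)|.
Definition rank_dist (a b : square) : nat := `|(a.2 : nat) - (b.2 : nat)|.

(* x lies in the bounding rectangle of a and b, is collinear with them, and
   differs from both. *)
Definition between (a b x : square) : bool :=
  [&& x != a, x != b,
      file_dist a x + file_dist x b == file_dist a b,
      rank_dist a x + rank_dist x b == rank_dist a b
    & file_dist a x * rank_dist a b == rank_dist a x * file_dist a b].

Definition clear_line (s : state) (a b : square) : bool :=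
  [forall x : square, between a b x ==> empty s x].

Definition rook_line (a b : square) : bool :=
  (a != b) && ((a.1 == b.1) || (a.2 == b.2)).
Definition bishop_line (a b : square) : bool :=
  (a != b) && (file_dist a b == rank_dist a b).

Definition attacks (s : state) (a b : square) : bool :=
  if board s a is Some p then
    match kind_of s p with
    | King => maxn (file_dist a b) (rank_dist a b) == 1
    | Queen => (rook_line a b || bishop_line a b) && clear_line s a b
    | Rook => rook_line a b && clear_line s a b
    | Bishop => bishop_line a b && clear_line s a b
    | Knight => file_dist a b * rank_dist a b == 2
    | Pawn =>
        (file_dist a b == 1) && (rank_for p.1 b == (rank_for p.1 a).+1)
    end
  else false.

Definition attacked_by (s : state) (c : color) (q : square) : bool :=
  [exists a : square,
    (if board s a is Some p then p.1 == c else false) && attacks s a q].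

Definition in_check (s : state) (c : color) : bool :=
  [exists q : square,
    (board s q == Some (king c)) && attacked_by s (opp c) q].

(** * Moves *)

Inductive wing := Kingside | Queenside.

(* [Shift a b k] moves the piece on a to b, promoting it to k' when
   k = Some k'; it covers every move other than castling, in particular
   en passant captures. *)
Inductive move :=
| Shift of square & square & option kind
| Castle of wing.

Definition rook_file w : 'I_8 := if w is Kingside then ord8 7 else ord8 0.
Definition castled_king_file w : 'I_8 :=
  if w is Kingside then ord8 6 else ord8 2.
Definition castled_rook_file w : 'I_8 :=
  if w is Kingside then ord8 5 else ord8 3.
Definition castling_rook c w : piece := (c, inr (rook_file w)).

(* The right to castle, irrespective of whether castling is prevented
   temporarily. *)
Definition castling_right (s : state) (c : color) (w : wing) : bool :=
  [&& board s (ord8 4, home_rank c) == Some (king c),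
      board s (rook_file w, home_rank c) == Some (castling_rook c w),
      ~~ moved s (king c) & ~~ moved s (castling_rook c w)].

Definition can_castle (s : state) (w : wing) : bool :=
  let c := turn s in
  let r := home_rank c in
  [&& castling_right s c w,
      clear_line s (ord8 4, r) (rook_file w, r),
      ~~ attacked_by s (opp c) (ord8 4, r),
      ~~ attacked_by s (opp c) (castled_rook_file w, r)
    & ~~ attacked_by s (opp c) (castled_king_file w, r)].

(* The pawn that moves as a pawn on move m, if any. *)
Definition moving_pawn (s : state) (m : move) : option piece :=
  if m is Shift a _ _ then
    if board s a is Some p then
      if kind_of s p == Pawn then Some p else None
    else None
  else None.

(* The pawn captured en passant stands beside the capturing pawn, on the file
   of the arrival square. *)
Definition en_passant_square (a b : square) : square := (b.1, a.2).

Definition en_passant (s : state) (a b : square) : bool :=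
  [&& moving_pawn s (Shift a b None) != None, attacks s a b, empty s b
    & double_step s == Some (en_passant_square a b)].

Definition pawn_reaches (s : state) (c : color) (a b : square) : bool :=
  [|| [&& a.1 == b.1, rank_for c b == (rank_for c a).+1 & empty s b],
      [&& a.1 == b.1, rank_for c a == 1, rank_for c b == 3, empty s b
        & clear_line s a b],
      attacks s a b && ~~ empty s b
    | en_passant s a b].

Definition can_shift (s : state) (a b : square) (k : option kind) : bool :=
  if board s a is Some p then
    [&& p.1 == turn s,
        if board s b is Some p' then (p'.1 != p.1) && (p' != king p'.1)
        else true,
        if kind_of s p == Pawn then pawn_reaches s p.1 a b else attacks s a b
      & if (kind_of s p == Pawn) && (rank_for p.1 b == 7)
        then k \in [:: Some Queen; Some Rook; Some Bishop; Some Knight]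
        else k == None]
  else false.

Definition do_move (s : state) (m : move) : state :=
  match m with
  | Shift a b k => {|
      turn := opp (turn s);
      board := fun q =>
        if q == b then board s a
        else if q == a then None
        else if en_passant s a b && (q == en_passant_square a b) then None
        else board s q;
      kind_of := fun p =>
        if k is Some k' then
          if board s a == Some p then k' else kind_of s p
        else kind_of s p;
      moved := fun p => (board s a == Some p) || moved s p;
      double_step :=
        if (moving_pawn s m != None) && (rank_dist a b == 2) then Some b
        else None
    |}
  | Castle w =>
      let c := turn s in
      let r := home_rank c in {|
      turn := opp c;
      board := fun q =>
        if q == (castled_king_file w, r) then Some (king c)
        else if q == (castled_rook_file w, r) then Some (castling_rook c w)
        else if (q == (ord8 4, r)) || (q == (rook_file w, r)) then None
        else board s q;
      kind_of := kind_of s;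
      moved := fun p => [|| p == king c, p == castling_rook c w | moved s p];
      double_step := None
    |}
  end.

Definition legal (s : state) (m : move) : bool :=
  match m with
  | Shift a b k => can_shift s a b k
  | Castle w => can_castle s w
  end && ~~ in_check (do_move s m) (turn s).

Definition pawn_move (s : state) (m : move) : bool := moving_pawn s m != None.

Definition capture (s : state) (m : move) : bool :=
  if m is Shift a b _ then ~~ empty s b || en_passant s a b else false.

Definition critical_move (s : state) (m : move) : bool :=
  pawn_move s m || capture s m.

(** * Ends of games *)

Definition checkmate (s : state) : Prop :=
  in_check s (turn s) /\ forall m, ~~ legal s m.

Definition stalemate (s : state) : Prop :=
  ~~ in_check s (turn s) /\ forall m, ~~ legal s m.

Fixpoint legal_sequence (s : state) (ms : seq move) : bool :=
  if ms is m :: ms' then legal s m && legal_sequence (do_move s m) ms'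
  else true.

Definition dead (s : state) : Prop :=
  ~ exists ms, legal_sequence s ms /\ checkmate (foldl do_move s ms).

Definition occupant (s : state) (q : square) : option (color * kind) :=
  omap (fun p => (p.1, kind_of s p)) (board s q).

(* Equality of legal moves accounts for en passant; equality of castling
   rights accounts for the remaining possible moves, those of the player not
   to move and those not immediately available. *)
Definition same_position (s s' : state) : Prop :=
  [/\ turn s = turn s',
      forall q, occupant s q = occupant s' q,
      forall c w, castling_right s c w = castling_right s' c w
    & forall m, legal s m = legal s' m].

(** * Games *)

(* The position after k plies. *)
Definition position (g : seq move) (k : nat) : state :=
  foldl do_move initial (take k g).

(* Plies are numbered from 1; ply t leads from position t.-1 to position t. *)
Definition ply (g : seq move) (t : nat) : move :=
  nth (Castle Kingside) g t.-1.

Definition at_ply A (P : state -> move -> A) (g : seq move) (t : nat) : A :=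
  P (position g t.-1) (ply g t).

Definition critical : seq move -> nat -> bool := at_ply critical_move.

Definition fivefold (g : seq move) (k : nat) : Prop :=
  exists A : {set 'I_k.+1}, 5 <= #|A| /\
    forall i j : 'I_k.+1, i \in A -> j \in A ->
      same_position (position g i) (position g j).

Definition seventy_five (g : seq move) (k : nat) : Prop :=
  150 <= k /\ forall t, k - 150 < t <= k -> ~~ critical g t.

Definition terminated (g : seq move) (k : nat) : Prop :=
  [\/ checkmate (position g k) \/ stalemate (position g k),
      dead (position g k), fivefold g k | seventy_five g k].

Definition is_game (g : seq move) : Prop :=
  [/\ legal_sequence initial g, terminated g (size g)
    & forall k, k < size g -> ~ terminated g k].

(** * Segments *)

Definition plies (g : seq move) : seq nat := iota 1 (size g).

(* The sequence t_1, ..., t_m *)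
Definition critical_plies (g : seq move) : seq nat :=
  [seq t <- plies g | critical g t].

(* T; the coercion of bool to nat gives its numerical value. *)
Definition tail (g : seq move) : bool :=
  (critical_plies g == [::]) || (last 0 (critical_plies g) < size g).

Definition segment_count (g : seq move) : nat :=
  size (critical_plies g) + tail g.

(* The sequence e_1, ..., e_K *)
Definition endpoints (g : seq move) : seq nat :=
  critical_plies g ++ (if tail g then [:: size g] else [::]).

Definition endpoint (g : seq move) (i : nat) : nat :=
  nth 0 (0 :: endpoints g) i.

(* In particular color_at 0 = Black. *)
Definition color_at (e : nat) : color := if odd e then White else Black.

Definition switches (g : seq move) (i : nat) : bool :=
  color_at (endpoint g i) != color_at (endpoint g i.-1).

Definition switch_count (g : seq move) : nat :=
  \sum_(1 <= i < (segment_count g).+1) switches g i.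

Definition segment_length (g : seq move) (i : nat) : int :=
  ((endpoint g i)%:Z - (endpoint g i.-1)%:Z)%R.

Definition max_length (g : seq move) (i : nat) : int :=
  (if switches g i then 149 else 150)%R.

Definition shortfall (g : seq move) (i : nat) : int :=
  (max_length g i - segment_length g i)%R.

(** * Counts *)

Definition pawn_capture (s : state) (m : move) : bool :=
  pawn_move s m && capture s m.

Definition pawn_move_count (g : seq move) : nat :=
  count (at_ply pawn_move g) (plies g).
Definition capture_count (g : seq move) : nat :=
  count (at_ply capture g) (plies g).
Definition pawn_capture_count (g : seq move) : nat :=
  count (at_ply pawn_capture g) (plies g).

Definition captures_as_pawn (g : seq move) (p : piece) : bool :=
  has (fun t => (at_ply moving_pawn g t == Some p) && at_ply capture g t)
      (plies g).

Definition resolved (g : seq move) (x : 'I_8) : bool :=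
  captures_as_pawn g (White, inl x) || captures_as_pawn g (Black, inl x).

Definition resolved_count (g : seq move) : nat :=
  #|[set x : 'I_8 | resolved g x]|.

Definition pawn_plies (g : seq move) (p : piece) : seq nat :=
  [seq t <- plies g | at_ply moving_pawn g t == Some p].

Definition one_rank (m : move) : bool :=
  if m is Shift a b _ then rank_dist a b == 1 else false.

Definition promotion (m : move) : bool :=
  if m is Shift _ _ k then k != None else false.

(** * Block patterns *)

Fixpoint block_pattern (s : seq color) : seq color :=
  if s is x :: s' then
    if s' is y :: _ then
      if x == y then block_pattern s' else x :: block_pattern s'
    else [:: x]
  else [::].

(* Main.v *)
Require Import Defs.
From mathcomp Require Import all_boot ssralg ssrint.
From mathcomp Require Import zify.

(**
A game of [K] segments with switch count [S] lasts [150 K - S] plies minus the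
sum of the shortfalls, and shortfalls are nonnegative: the seventy-five-move
rule caps every segment at 150 plies, and a segment whose endpoints have
different colours has odd length. Everything therefore rests on an upper bound
for [K] and, when it is attained, a lower bound for [S].

Upper bound for [K]. Counting critical moves by inclusion and exclusion gives
[K = P + C - Cp + T]. A pawn climbs only six ranks, so it makes at most six
pawn moves. If no member of an origin pair captures as a pawn, both stay on
their file; until one of them is gone, neither can get past the other, and
whichever is removed first has climbed at most four ranks. Such a pair makes
at most ten moves, so [P <= 80 + 2 f]. Distinct resolved pairs use distinct
pawn captures, so [f <= Cp]. Kings are never captured, so [C <= 30]; the
thirtieth capture leaves bare kings, a dead position, and ends the game, so
[C + T <= 30] ([captures_and_tail]). Altogether [K <= 110 + f <= 118]. As
[150 * 117 < 17697], the game has [K = 118], every inequality above is an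
equality, and [S] plus the sum of the shortfalls is 3.

Lower bound for [S]. Now every pawn makes six one-rank moves, the sixth being
a promotion. Fix a colour [c]. As at least 29 captures occur, some pawn of [c]
is eventually captured, necessarily by the opponent and after its promotion.
Just before promoting it stands on the home square of an opposing pawn, which
must have moved already. So the opponent makes critical moves both before and
after this promotion ([critical_alternation]), and the colours of the critical
moves contain both WBW and BWB as subsequences. Preceded by the virtual Black
endpoint, a colour sequence with these subsequences has at least three
switches, and with exactly three its block pattern is BWBW
([alternation_BWBW]).
*)

Set Implicit Arguments.
Unset Strict Implicit.
Unset Printing Implicit Defensive.

(** * Positions reachable by legal moves *)

Definition alive (s : state) : {set piece} :=
  [set p | [exists q, board s q == Some p]].

Definition victim (s : state) (m : move) : option piece :=
  if m is Shift a b _ then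
    if en_passant s a b then board s (en_passant_square a b) else board s b
  else None.

(** Facts about reachable positions that an arbitrary [state] may violate. The
clause on [double_step] guarantees that an en passant capture removes a pawn
of the opponent; [waiting_not_in_check] records that the last move was legal,
which decides the positions with bare kings. *)
Record sound (s : state) : Prop := Sound {
  board_inj : forall q q' p, board s q = Some p -> board s q' = Some p -> q = q';
  officer_kind : forall c x, kind_of s (c, inr x) = kind_of initial (c, inr x);
  king_alive : forall c, king c \in alive s;
  double_step_pawn : forall q, double_step s = Some q ->
    exists p, [/\ board s q = Some p, kind_of s p = Pawn & p.1 != turn s];
  waiting_not_in_check : ~~ in_check s (opp (turn s))
}.

Lemma aliveP s p : reflect (exists q, board s q = Some p) (p \in alive s).
Proof.
by rewrite inE; apply: (iffP existsP) => -[q /eqP]; exists q.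
Qed.

Lemma oppK : involutive opp. Proof. by case. Qed.
Lemma opp_neq c : opp c != c. Proof. by case: c. Qed.
Lemma neq_opp c d : (c != d) = (c == opp d). Proof. by case: c d => [] []. Qed.

Lemma do_move_turn s m : turn (do_move s m) = opp (turn s).
Proof. by case: m. Qed.

Lemma can_shiftP s a b k : can_shift s a b k ->
  exists p, [/\ board s a = Some p, p.1 = turn s,
    if board s b is Some p' then p'.1 <> p.1 /\ p' <> king p'.1 else True,
    if kind_of s p == Pawn then pawn_reaches s p.1 a b else attacks s a b
    & if (kind_of s p == Pawn) && (rank_for p.1 b == 7)
      then k \in [:: Some Queen; Some Rook; Some Bishop; Some Knight]
      else k == None].
Proof.
rewrite /can_shift; case: (board s a) => // p /and4P[/eqP ? h ? ?]; exists p.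
by split=> //; case: (board s b) h => // p' /andP[/eqP ? /eqP ?].
Qed.

Lemma moving_pawnP s m p : moving_pawn s m = Some p ->
  exists a b k, [/\ m = Shift a b k, board s a = Some p & kind_of s p = Pawn].
Proof.
case: m => //= a b k; case ba: (board s a) => [p'|] //; case: eqP => // ? [<-].
by exists a, b, k.
Qed.

Lemma pawn_identity s p : sound s -> kind_of s p = Pawn -> exists c x, p = (c, inl x).
Proof.
case: p => c [] x hs; first by exists c, x.
by rewrite officer_kind //=; case: x => [[|[|[|[|[|[|[|[|]]]]]]]]].
Qed.

Lemma king_kind s c : sound s -> kind_of s (king c) = King.
Proof. by move=> hs; rewrite officer_kind. Qed.

Lemma en_passantP s a b : sound s -> en_passant s a b ->
  exists v, [/\ board s (en_passant_square a b) = Some v, kind_of s v = Pawn,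
    v.1 != turn s & empty s b].
Proof.
move=> hs /and4P[_ _ he /eqP/(double_step_pawn hs)[v [? ? ?]]].
by exists v.
Qed.

Lemma shift_neq s a b k : can_shift s a b k -> a != b.
Proof.
case/can_shiftP=> p [pa _ ob _ _]; apply/eqP=> ab.
by move: ob; rewrite -ab pa => -[/(_ erefl)].
Qed.

(** Kings are safe from en passant captures because the victim of one is a
pawn, and officers never acquire that kind. *)
Lemma victimP s m v : sound s -> legal s m -> victim s m = Some v ->
  [/\ v \in alive s, v.1 != turn s & v <> king v.1].
Proof.
move=> hs /andP[+ _]; case: m => [a b k|w] //= /can_shiftP[p [pa tp + _ _]].
case: ifP => [/(en_passantP hs)[v' [bv kv cv _]] _|_ ob bv].
  rewrite bv => -[<-]; split=> //; first by apply/aliveP; eexists; exact: bv.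
  by move=> vk; move: kv; rewrite vk king_kind.
move: ob; rewrite bv => -[cv vk]; split=> //; first by apply/aliveP; exists b.
by rewrite -tp; apply/eqP.
Qed.

Lemma capture_victim s m : sound s ->
  capture s m = (victim s m != None).
Proof.
move=> hs; case: m => [a b k|w] //=.
case: ifP => [/(en_passantP hs)[v [-> _ _ _]]|_]; first by rewrite orbT.
by rewrite orbF.
Qed.

Lemma alive_shift s a b k : sound s -> legal s (Shift a b k) ->
  alive (do_move s (Shift a b k)) =
  alive s :\: [set p | victim s (Shift a b k) == Some p].
Proof.
move=> hs hl; have [hm _] := andP hl.
apply/setP=> p; rewrite in_setD [X in ~~ X]in_set; apply/idP/idP.
  case/aliveP=> q /=; case: eqP => [_ pa|qb].
    apply/andP; split; last by apply/aliveP; exists a.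
    apply/eqP=> /(victimP hs hl)[_ cp _]; case/can_shiftP: hm => p' [pa' tp' _ _ _].
    by move: pa'; rewrite pa => -[pp']; case/eqP: cp; rewrite pp'.
  case: eqP => // qa; case: ifP => // ne bq; apply/andP; split; last by apply/aliveP; exists q.
  apply/eqP; case: ifP ne => /= ep ne vi; last by case: qb; exact: board_inj vi.
  by move: ne; rewrite (board_inj hs bq vi) eqxx.
case/andP=> vi /aliveP[q bq]; apply/aliveP.
have [qa|qa] := eqVneq q a; first by exists b => /=; rewrite eqxx -qa.
exists q => /=; rewrite (negPf qa); move: vi => /=.
have [qb|qb] := eqVneq q b; case: ifP => /= ep.
- by have [? [_ _ _]] := en_passantP hs ep; rewrite /empty -qb bq.
- by rewrite -qb bq eqxx.
- by case: (q =P en_passant_square a b) => [<-|//]; rewrite bq eqxx.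
- by [].
Qed.

Lemma castle_path c w (r := home_rank c) :
  between (ord8 4, r) (rook_file w, r) (castled_king_file w, r) /\
  between (ord8 4, r) (rook_file w, r) (castled_rook_file w, r).
Proof. by case: c w @r => [] [] /=; split; vm_compute. Qed.

Lemma castle_squares s w (c := turn s) (r := home_rank c) : can_castle s w ->
  [/\ board s (ord8 4, r) = Some (king c),
      board s (rook_file w, r) = Some (castling_rook c w),
      board s (castled_king_file w, r) = None
    & board s (castled_rook_file w, r) = None].
Proof.
case/and5P=> /and4P[/eqP ? /eqP ? _ _] /forallP cl _ _ _.
have emp q : between (ord8 4, r) (rook_file w, r) q -> board s q = None.
  by move=> bq; have := cl q; rewrite bq => /eqP.
by split=> //; apply: emp; have [] := castle_path c w.
Qed.

Lemma castled_neq w (r : 'I_8) :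
  [/\ ((castled_king_file w, r) == (castled_rook_file w, r)) = false,
      ((ord8 4, r) == (rook_file w, r)) = false &
      ((rook_file w, r) == (ord8 4, r)) = false].
Proof. by rewrite !xpair_eqE; case: w. Qed.

Lemma alive_castle s w : can_castle s w ->
  alive (do_move s (Castle w)) = alive s.
Proof.
move=> hc; have [bk br ek er] := castle_squares hc.
set r := home_rank _ in bk br ek er; have [n1 n2 n3] := castled_neq w r.
apply/setP=> p; apply/aliveP/aliveP => -[q] /=; rewrite -/r.
  case: eqP => [_ [<-]|_]; first by exists (ord8 4, r).
  case: eqP => [_ [<-]|_]; first by exists (rook_file w, r).
  by case: ifP => // _; exists q.
have [->|q4] := eqVneq q (ord8 4, r).
  by rewrite bk => -[<-]; exists (castled_king_file w, r); rewrite eqxx.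
have [->|q7] := eqVneq q (rook_file w, r).
  rewrite br => -[<-]; exists (castled_rook_file w, r).
  by rewrite eq_sym n1 eqxx.
move=> bq; exists q; rewrite (negPf q4) (negPf q7) /=.
case: eqP bq => [->|_]; first by rewrite ek.
by case: eqP => // ->; rewrite er.
Qed.

(** A capture removes exactly one piece and any other move none; this is the
whole material balance of the game. *)
Lemma alive_do_move s m : sound s -> legal s m ->
  alive (do_move s m) = alive s :\: [set p | victim s m == Some p].
Proof.
move=> hs; case: m => [a b k|w] hl; first exact: alive_shift.
case/andP: hl => /alive_castle-> _; apply/setP=> p.
by rewrite in_setD [X in ~~ X]in_set.
Qed.

Lemma board_inj_do_move s m q q' p : sound s -> legal s m ->
  board (do_move s m) q = Some p -> board (do_move s m) q' = Some p -> q = q'.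
Proof.
move=> hs /andP[hm _].
(* Two distinct squares cannot both have held p before the move, so one of
   them, say q', received p by this move. *)
wlog: q q' / ~~ (board s q' == Some p).
  move=> W; case: (boolP (board s q' == Some p)) => [bq'|]; last exact: W.
  case: (boolP (board s q == Some p)) => [bq|nq h h']; last by apply/esym/W.
  by rewrite (board_inj hs (eqP bq) (eqP bq')).
case: m hm => [a b k|w] hm /= nq'.
  have ab := shift_neq hm.
  case: (q' =P b) => [->|_]; last first.
    by move=> _; do 2![case: ifP => // _]; move/eqP; rewrite (negPf nq').
  case: eqP => // _; case: eqP => // qa; case: ifP => // _ bq ba.
  by case: qa; exact: board_inj ba.
have [bk br ek er] := castle_squares hm.
set r := home_rank _ in bk br ek er *; have [n1 n2 n3] := castled_neq w r.
case: (q' =P _) => [->|_].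
  case: eqP => // _; case: eqP => [_ [<-] []//|_]; first by case: (w).
  case: ifP => // /negbT; rewrite negb_or => /andP[/eqP q4 _] bq [pk].
  by case: q4; apply: board_inj bq _ => //; rewrite -pk.
case: (q' =P _) => [->|_].
  case: eqP => [_ [<-] []//|_]; first by case: (w).
  case: eqP => // _.
  case: ifP => // /negbT; rewrite negb_or => /andP[_ /eqP q4] bq [pk].
  by case: q4; apply: board_inj bq _ => //; rewrite -pk.
by move=> _; case: ifP => // _ /eqP; rewrite (negPf nq').
Qed.

Lemma rank_for_le7 c q : rank_for c q <= 7.
Proof. by have := ltn_ord q.2; rewrite /rank_for; case: c; lia. Qed.

Lemma rank_for_opp c q : rank_for (opp c) q = 7 - rank_for c q.
Proof. by have := ltn_ord q.2; rewrite /rank_for; case: c => /=; lia. Qed.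

Lemma rank_for_inj c q r : q.1 = r.1 -> rank_for c q = rank_for c r -> q = r.
Proof.
case: q r => [f q] [f' r] /= ->; have := ltn_ord q; have := ltn_ord r.
by rewrite /rank_for; case: c => /= ? ? e; congr (_, _); apply: val_inj => /=; lia.
Qed.

(** The climb is measured by [rank_dist], so that climbs along the game add up
to the rank of the pawn. *)
Lemma pawn_reachesP s a b p : board s a = Some p -> kind_of s p = Pawn ->
  pawn_reaches s p.1 a b ->
  [/\ rank_for p.1 b = rank_for p.1 a + rank_dist a b,
      0 < rank_dist a b,
      ~~ (~~ empty s b || en_passant s a b) -> a.1 = b.1 /\ empty s b
    & [\/ rank_dist a b = 1 |
      [/\ rank_dist a b = 2, rank_for p.1 b = 3, a.1 = b.1 & clear_line s a b]]].
Proof.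
move=> ba kp.
have ra := ltn_ord a.2; have rb := ltn_ord b.2.
have d1 : rank_for p.1 b = (rank_for p.1 a).+1 -> rank_dist a b = 1.
  by rewrite /rank_for /rank_dist; case: (p.1); lia.
have d2 : rank_for p.1 b = 3 -> rank_for p.1 a = 1 -> rank_dist a b = 2.
  by rewrite /rank_for /rank_dist; case: (p.1); lia.
have att : attacks s a b -> rank_for p.1 b = (rank_for p.1 a).+1.
  by rewrite /attacks ba kp => /andP[_ /eqP].
case/or4P=> [/and3P[/eqP fab /eqP rab eb]|/and5P[/eqP fab /eqP ra1 /eqP rb3 eb cl]|
             /andP[/att rab ->]|ep].
- by rewrite (d1 rab) rab addn1; split=> //; left.
- by rewrite (d2 rb3 ra1) rb3 ra1; split=> //; right.
- by rewrite (d1 rab) rab addn1; split=> //; left.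
- have /and4P[_ /att rab _ _] := ep.
  by rewrite (d1 rab) rab addn1 ep orbT; split=> //; left.
Qed.

Lemma sound_do_move s m : sound s -> legal s m -> sound (do_move s m).
Proof.
move=> hs hl; split.
- by move=> q q' p; apply: board_inj_do_move.
- move=> c x; rewrite -(officer_kind hs); case: m hl => //= a b [k|] // /andP[+ _].
  case/can_shiftP=> p [-> _ _ _]; case: ifP => // /andP[/eqP kp _] _.
  by case: eqP => // -[pc]; have [c' [y]] := pawn_identity hs kp; rewrite pc.
- move=> c; rewrite alive_do_move // in_setD king_alive // andbT [X in ~~ X]in_set.
  by apply/eqP=> /(victimP hs hl)[_ _ []].
- move=> q; rewrite do_move_turn; case: m hl => //= a b k /andP[+ _].
  case/can_shiftP=> p [pa tp _].
  rewrite pa; case: eqP => //= kp pr kr; case: eqP => // rd [<-].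
  exists p; rewrite eqxx tp neq_opp oppK; split=> //.
  have [_ _ _ [|[_ rb _ _]]] := pawn_reachesP pa kp pr; first by rewrite rd.
  by move: kr; rewrite rb /= => /eqP->.
- by rewrite do_move_turn oppK; case/andP: hl.
Qed.

(** * Bare kings *)

Lemma alive_do_move_sub s m : sound s -> legal s m ->
  alive (do_move s m) \subset alive s.
Proof. by move=> hs hl; rewrite alive_do_move // subsetDl. Qed.

Lemma kings_sub s : sound s -> [set king White; king Black] \subset alive s.
Proof. by move=> hs; apply/subsetP=> p /set2P[]->; apply: king_alive. Qed.

(** Adjacency of kings is symmetric: a check by the enemy king would also be a
check on the player who has just moved, who may not have moved into it. *)
Lemma bare_kings_no_check s : sound s -> alive s \subset [set king White; king Black] ->
  ~~ in_check s (turn s).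
Proof.
move=> hs hk; apply/negP=> /existsP[q /andP[/eqP bq /existsP[a /andP[]]]].
case ba: (board s a) => [p|] // /eqP cp; rewrite /attacks ba.
have pk : p = king (opp (turn s)).
  have /(subsetP hk)/set2P : p \in alive s by apply/aliveP; exists a.
  by rewrite -cp => -[]->.
rewrite {}pk king_kind // in ba * => da.
case/negP: (waiting_not_in_check hs); apply/existsP; exists a.
rewrite ba eqxx oppK /=; apply/existsP; exists q.
rewrite bq eqxx /attacks bq king_kind //=.
by rewrite /file_dist /rank_dist ![`|(q.1 : nat) - _|]distnC ![`|(q.2 : nat) - _|]distnC.
Qed.

Lemma legal_sequence_sound s ms : sound s -> legal_sequence s ms ->
  sound (foldl do_move s ms) /\ alive (foldl do_move s ms) \subset alive s.
Proof.
elim: ms s => //= m ms IH s hs /andP[hl /IH[|ss sa]]; first exact: sound_do_move.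
by split=> //; apply: subset_trans sa _; apply: alive_do_move_sub.
Qed.

(** Checkmate needs a check, and no check can arise from bare kings: no piece
ever returns to the board. *)
Lemma bare_kings_dead s : sound s -> #|alive s| <= 2 -> dead s.
Proof.
move=> hs h2 [ms [/(legal_sequence_sound hs)[ss sa] [ck _]]].
apply/negP: ck; apply: bare_kings_no_check => //; apply: subset_trans sa _.
have /eqP-> // : [set king White; king Black] == alive s.
by rewrite eqEcard kings_sub //= cards2.
Qed.

(** * Positions along a game *)

Lemma sound_initial : sound initial.
Proof.
split=> //.
- move=> [f r] [f' r'] p /=.
  case: r => [[|[|[|[|[|[|[|[|]]]]]]]] hr] //= -[<-];
  case: r' => [[|[|[|[|[|[|[|[|]]]]]]]] hr'] //= -[<-];
  by rewrite (bool_irrelevance hr hr').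
- move=> c; apply/aliveP; exists (ord8 4, home_rank c); by case: c.
- apply/negP=> /existsP[q /andP[/eqP bq /existsP[a /andP[]]]].
  have {bq} -> : q = (ord8 4, ord8 7).
    case: q bq => [f [[|[|[|[|[|[|[|[|]]]]]]]] hr]] //= -[->].
    by congr (_, _); apply: val_inj.
  (* It remains to try the sixteen White pieces, none of which attacks e8. *)
  case: a => -[f hf] [r hr].
  do 8?[case: r hr => [|r] hr //=] => _;
  by do 8?[case: f hf => [|f] hf //]; vm_compute.
Qed.

Lemma legal_nth m0 s ms k : legal_sequence s ms -> k < size ms ->
  legal (foldl do_move s (take k ms)) (nth m0 ms k).
Proof.
elim: ms s k => //= m ms IH s [|k] /andP[hl hms]; first by [].
by rewrite ltnS => /(IH _ _ hms).
Qed.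

Lemma positionS g k : k < size g ->
  position g k.+1 = do_move (position g k) (ply g k.+1).
Proof.
by move=> hk; rewrite /position (take_nth (Castle Kingside) hk) foldl_rcons.
Qed.

Lemma legal_ply g k : legal_sequence initial g -> k < size g ->
  legal (position g k) (ply g k.+1).
Proof. by move=> hg hk; apply: legal_nth. Qed.

Lemma sound_position g k : legal_sequence initial g -> k <= size g -> sound (position g k).
Proof.
move=> hg; elim: k => [|k IH] hk; first by rewrite /position take0; apply: sound_initial.
by rewrite positionS //; apply: sound_do_move; [apply/IH/ltnW | apply: legal_ply].
Qed.

Lemma turn_position g k : k <= size g -> turn (position g k) = color_at k.+1.
Proof.
elim: k => [|k IH] hk; first by rewrite /position take0.
by rewrite positionS // do_move_turn IH 1?ltnW // /color_at /=; case: (odd k).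
Qed.

(** * How far pawns climb *)

Definition active_pawn (s : state) (p : piece) : bool :=
  (p \in alive s) && (kind_of s p == Pawn).

Definition rise (m : move) : nat := if m is Shift a b _ then rank_dist a b else 0.

Definition pawn_plies_to (g : seq move) (p : piece) (k : nat) : seq nat :=
  [seq t <- iota 1 k | at_ply moving_pawn g t == Some p].

(** Total number of ranks climbed up to ply [k]. Double steps count twice, so
that this determines the rank of the pawn. *)
Definition advance g p k : nat := \sum_(t <- pawn_plies_to g p k) rise (ply g t).

Definition captures_as_pawn_to g p k : bool :=
  has (fun t => (at_ply moving_pawn g t == Some p) && at_ply capture g t) (iota 1 k).

Lemma active_pawnP s p :
  reflect (exists q, board s q = Some p /\ kind_of s p = Pawn) (active_pawn s p).
Proof.
apply: (iffP andP) => [[/aliveP[q bq] /eqP kp]|[q [bq /eqP kp]]]; first by exists q.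
by split=> //; apply/aliveP; exists q.
Qed.

Lemma moving_pawn_is_active s m p : moving_pawn s m = Some p -> active_pawn s p.
Proof. by case/moving_pawnP=> a [b [k [_ ba kp]]]; apply/active_pawnP; exists a. Qed.

Lemma moving_pawn_turn s m p : legal s m -> moving_pawn s m = Some p -> p.1 = turn s.
Proof.
move=> hl /moving_pawnP[a [b [k [em ba _]]]]; move: hl; rewrite em => /andP[+ _].
by case/can_shiftP=> p' [+ <- _ _ _]; rewrite ba => -[->].
Qed.

Lemma legal_pawn_move s m p : sound s -> legal s m -> moving_pawn s m = Some p ->
  exists a b k, [/\ m = Shift a b k, board s a = Some p, kind_of s p = Pawn,
    pawn_reaches s p.1 a b & board (do_move s m) b = Some p /\
    (rank_for p.1 b = 7 /\ k != None /\ kind_of (do_move s m) p != Pawn \/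
    rank_for p.1 b <> 7 /\ k = None)].
Proof.
move=> hs hl /moving_pawnP[a [b [k [em ba kp]]]].
exists a, b, k; move: hl; rewrite em => /andP[+ _].
case/can_shiftP=> p' []; rewrite ba => -[<-] _ _; rewrite kp eqxx /= => pr hk.
split=> //=; split; first by rewrite eqxx.
case: eqP hk => [r7 hk|r7 /eqP]; [left; move: hk|by right].
by rewrite !inE ba eqxx => /or4P[]/eqP->.
Qed.

Lemma unmoved_pawn s m p q : sound s -> legal s m -> moving_pawn s m <> Some p ->
  board (do_move s m) q = Some p -> kind_of (do_move s m) p = Pawn ->
  board s q = Some p /\ kind_of s p = Pawn.
Proof.
move=> hs hl mp bq kp.
have kp' : kind_of s p = Pawn.
  case: m hl {mp bq} kp => //= a b [k|] // /andP[+ _].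
  case/can_shiftP=> p' [-> _ _ _]; case: ifP => // _; case: eqP => // _.
  by rewrite !inE => /or4P[]/eqP[->].
split=> //; have [c [x px]] := pawn_identity hs kp'.
case: m hl mp bq {kp} => [a b k|w] hl mp /=.
  case: eqP => [_ ba|_]; first by case: mp; rewrite /= ba kp' eqxx.
  by case: eqP => // _; case: ifP.
by rewrite px; case: eqP => // _; case: eqP => // _; case: ifP.
Qed.

Lemma active_pawn_do_move s m p : sound s -> legal s m ->
  active_pawn (do_move s m) p -> active_pawn s p.
Proof.
move=> hs hl /active_pawnP[q [bq kp]].
case mp: (moving_pawn s m == Some p); first exact: moving_pawn_is_active (eqP mp).
have [? ?] := unmoved_pawn hs hl (elimF eqP mp) bq kp.
by apply/active_pawnP; exists q.
Qed.

Lemma pawn_plies_toS g p k : pawn_plies_to g p k.+1 =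
  pawn_plies_to g p k ++
  (if moving_pawn (position g k) (ply g k.+1) == Some p then [:: k.+1] else [::]).
Proof. by rewrite /pawn_plies_to -[k.+1]addn1 iotaD filter_cat /= add1n addn1. Qed.

Lemma advanceS g p k : advance g p k.+1 = advance g p k +
  (if moving_pawn (position g k) (ply g k.+1) == Some p then rise (ply g k.+1) else 0).
Proof.
by rewrite /advance pawn_plies_toS big_cat /=; case: ifP; rewrite ?big_seq1 ?big_nil.
Qed.

Lemma captures_as_pawn_toS g p k : captures_as_pawn_to g p k.+1 =
  captures_as_pawn_to g p k ||
  ((moving_pawn (position g k) (ply g k.+1) == Some p) &&
    capture (position g k) (ply g k.+1)).
Proof. by rewrite /captures_as_pawn_to -[k.+1]addn1 iotaD has_cat /= add1n addn1 orbF. Qed.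

(** The bound 6 survives capture and promotion because the climb is then
frozen. The second part ties the history of a pawn to its square: it loses its
initial file only by capturing, and it never stays a pawn on the last rank. *)
Lemma pawn_location g k c x : legal_sequence initial g -> k <= size g ->
  let p := (c, inl x) in
  advance g p k <= 6 /\
  forall q, board (position g k) q = Some p -> kind_of (position g k) p = Pawn ->
  [/\ rank_for c q = (advance g p k).+1, rank_for c q <> 7
    & ~~ captures_as_pawn_to g p k -> q.1 = x].
Proof.
move=> hg + p; elim: k => [|k IH] hk.
  rewrite /advance /position take0 /= big_nil; split=> // q bq _.
  have /= : rank_for c q = 1 /\ q.1 = x; last by case=> -> ->.
  case: q bq => f [r hr]; rewrite /p /=; do 8?[case: r hr => [|r] hr //=].
    by case=> <- <-.
  by case=> <- <-.
have hs := sound_position hg (ltnW hk); have hl := legal_ply hg hk.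
have [IH6 {IH}IH] := IH (ltnW hk).
rewrite advanceS captures_as_pawn_toS positionS //.
set s := position g k in hs hl IH *; set m := ply g k.+1 in hl *.
case: eqP => [mp|mp]; last first.
  rewrite addn0 orbF; split=> // q bq kq.
  by have [bq' kq'] := unmoved_pawn hs hl mp bq kq; apply: IH.
have [a [b [k' [em ba kp pr [bb pk]]]]] := legal_pawn_move hs hl mp.
have [ra _ fa] := IH a ba kp.
have [rb _ fb _] := pawn_reachesP ba kp pr.
have -> : rise m = rank_dist a b by rewrite em.
have -> : capture s m = ~~ empty s b || en_passant s a b by rewrite em.
rewrite /= in rb pk.
have r7 := rank_for_le7 c b.
split; first by lia.
move=> q bq kq; have {bq} -> : q = b by apply: board_inj (sound_do_move hs hl) _ _ _ bq bb.
split; first by lia.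
  by case: pk => [[_ [_]]|[]//]; rewrite kq.
rewrite negb_or => /andP[/fa <- /fb]; by case.
Qed.

Lemma size_pawn_plies_to g k c x : legal_sequence initial g -> k <= size g ->
  size (pawn_plies_to g (c, inl x) k) <= advance g (c, inl x) k.
Proof.
move=> hg; elim: k => [|k IH] hk //.
rewrite advanceS pawn_plies_toS size_cat.
apply: leq_add; first exact/IH/ltnW.
case: eqP => [mp|_]; last by [].
have hs := sound_position hg (ltnW hk); have hl := legal_ply hg hk.
have [a [b [k' [em ba kp pr _]]]] := legal_pawn_move hs hl mp.
by have [_ + _ _] := pawn_reachesP ba kp pr; rewrite em.
Qed.

(** The pawns [p] and [p'] of an origin pair have not got past each other, or
one of them vanished before that could happen. Facing each other on one file,
[p] on rank [1 + advance p] and [p'] on rank [6 - advance p'], counted from 0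
on the side of [p], are in order exactly when the advances sum to at most 4.
Every alternative bounds one of the two advances by 4, and once inactive a
pawn climbs no further. *)
Definition blocked g p p' k :=
  [\/ advance g p k + advance g p' k <= 4,
      ~~ active_pawn (position g k) p /\ advance g p k <= 4 |
      ~~ active_pawn (position g k) p' /\ advance g p' k <= 4].

(** The opposing pawn stops a single step by occupying the arrival square and a
double step by occupying that square or the one passed over. *)
Lemma blocked_pawn_move g k c x (p := (c, inl x)) (p' := (opp c, inl x)) :
  legal_sequence initial g -> k < size g ->
  ~~ captures_as_pawn_to g p k.+1 -> ~~ captures_as_pawn_to g p' k ->
  active_pawn (position g k) p' ->
  moving_pawn (position g k) (ply g k.+1) = Some p ->
  advance g p k + advance g p' k <= 4 ->
  advance g p k.+1 + advance g p' k.+1 <= 4.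
Proof.
move=> hg hk cp cp' /active_pawnP[q [bq kq]] mp h4.
have hs := sound_position hg (ltnW hk); have hl := legal_ply hg hk.
rewrite !advanceS mp eqxx; case: eqP => [[]|_]; first by case: (c).
rewrite addn0; move: cp; rewrite captures_as_pawn_toS negb_or mp eqxx => /andP[cp nc].
have [a [b [k' [em ba kp pr [bb pk]]]]] := legal_pawn_move hs hl mp.
have [_ /(_ a ba kp)[ra _ /(_ cp) fa]] := pawn_location c x hg (ltnW hk).
have [_ /(_ q bq kq)[rq _ /(_ cp') fq]] := pawn_location (opp c) x hg (ltnW hk).
have [rb rd /= fb st] := pawn_reachesP ba kp pr.
move: nc; rewrite em /= => /fb[fab /eqP eb].
rewrite -/p' in rq; rewrite -/p in ra.
have rqc : rank_for c q + advance g p' k = 6.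
  by have := rank_for_le7 c q; move: rq; rewrite rank_for_opp; lia.
rewrite /= in rb st; have [lt|ge] := ltnP (rank_for c b) (rank_for c q); first by lia.
have [e|ne] := eqVneq (rank_for c b) (rank_for c q).
  by move: eb; rewrite (rank_for_inj _ e) ?bq // -fab fa fq.
(* Here p' would stand strictly between the ends of a double step. *)
case: st => [|[r2 _ _ /forallP/(_ q)]]; first by lia.
rewrite /empty bq implybF => /negP[]; have := ltn_ord q.2; have := ltn_ord a.2.
have := ltn_ord b.2; rewrite /between /file_dist.
have xa : a != q by apply/eqP=> aq; rewrite aq in ra; lia.
have xb : b != q by apply: contraNneq ne => ->.
have lr : rank_for c a < rank_for c q by lia.
rewrite ![q == _]eq_sym xa xb -fab fa fq !distnn addn0 eqxx /= muln0 mul0n eqxx andbT.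
by move: ra rb ge ne r2 lr; rewrite /rank_dist /rank_for; case: (c) => /=; lia.
Qed.

Lemma unresolved_blocked g k c x (p := (c, inl x)) (p' := (opp c, inl x)) :
  legal_sequence initial g -> k <= size g ->
  ~~ captures_as_pawn_to g p k -> ~~ captures_as_pawn_to g p' k -> blocked g p p' k.
Proof.
move=> hg; elim: k => [|k IH] hk; first by move=> _ _; apply: Or31; rewrite /advance !big_nil.
rewrite /blocked => np np'; have := np; have := np'; rewrite 2!captures_as_pawn_toS !negb_or.
move=> /andP[np1' _] /andP[np1 _].
have hs := sound_position hg (ltnW hk); have hl := legal_ply hg hk.
have keep r : ~~ active_pawn (position g k) r -> ~~ active_pawn (position g k.+1) r /\
    advance g r k.+1 = advance g r k.
  move=> nr; split; first by rewrite positionS //; apply: contra nr; apply: active_pawn_do_move.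
  by rewrite advanceS; case: eqP => [/moving_pawn_is_active|]; rewrite ?(negPf nr) ?addn0.
case: (IH (ltnW hk) np1 np1') => [h4|[na h4]|[na h4]]; last 2 first.
- by have [? ->] := keep _ na; apply: Or32.
- by have [? ->] := keep _ na; apply: Or33.
have [ap|ap] := boolP (active_pawn (position g k) p); last first.
  by have [? e] := keep _ ap; apply: Or32; split=> //; rewrite e; lia.
have [ap'|ap'] := boolP (active_pawn (position g k) p'); last first.
  by have [? e] := keep _ ap'; apply: Or33; split=> //; rewrite e; lia.
apply: Or31.
case mp: (moving_pawn (position g k) (ply g k.+1) == Some p).
  by apply: blocked_pawn_move => //; apply/eqP.
case mp': (moving_pawn (position g k) (ply g k.+1) == Some p').
  rewrite addnC; have -> : p = (opp (opp c), inl x) by rewrite oppK.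
  by apply: blocked_pawn_move; rewrite ?oppK // ?(eqP mp') // addnC.
by rewrite !advanceS mp mp' !addn0.
Qed.

(** The pawn that remains blocked makes at most four moves, the other one at
most six. *)
Lemma unresolved_moves g k c x (p := (c, inl x)) (p' := (opp c, inl x)) :
  legal_sequence initial g -> k <= size g ->
  ~~ captures_as_pawn_to g p k -> ~~ captures_as_pawn_to g p' k ->
  size (pawn_plies_to g p k) + size (pawn_plies_to g p' k) <= 10.
Proof.
move=> hg hk np np'.
have := unresolved_blocked hg hk np np'.
have [a6 _] := pawn_location c x hg hk; have [a6' _] := pawn_location (opp c) x hg hk.
have := size_pawn_plies_to c x hg hk; have := size_pawn_plies_to (opp c) x hg hk.
by rewrite -/p -/p' in a6 a6' * => n n' []; [|case=> _..]; lia.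
Qed.

(** * Counting captures and pawn moves *)

Lemma card_piece : #|{: piece}| = 32.
Proof.
rewrite card_prod card_sum !card_ord.
suff -> : #|{: color}| = 2 by [].
have bij : bijective bool_of_color by exists color_of_bool => [|[]]; first exact: bool_of_colorK.
by rewrite (bij_eq_card bij) card_bool.
Qed.

Lemma alive_initial : alive initial = [set: piece].
Proof.
apply/setP=> -[c [x|x]]; rewrite in_setT; apply/aliveP.
  by exists (x, if c is White then ord8 1 else ord8 6); case: c.
by exists (x, home_rank c); case: c.
Qed.

Lemma iota1S k : iota 1 k.+1 = iota 1 k ++ [:: k.+1].
Proof. by rewrite -{1}[k.+1]addn1 iotaD add1n. Qed.

Lemma card_alive g k : legal_sequence initial g -> k <= size g ->
  #|alive (position g k)| + count (at_ply capture g) (iota 1 k) = 32.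
Proof.
move=> hg; elim: k => [|k IH] hk.
  by rewrite /position take0 alive_initial cardsT card_piece.
have hs := sound_position hg (ltnW hk); have hl := legal_ply hg hk.
rewrite iota1S count_cat -(IH (ltnW hk)) /= positionS // alive_do_move //.
rewrite /at_ply /= addn0 capture_victim //.
case vi: victim => [v|].
  have [va _ _] := victimP hs hl vi.
  rewrite (cardsD1 v (alive _)) va add1n addn1 addnS addSn; congr (_ + _).+1.
  by apply: eq_card => p; rewrite !inE eq_sym.
rewrite !addn0; congr (_ + _).
by apply: eq_card => p; rewrite in_setD [X in ~~ X]in_set.
Qed.

Lemma card_alive_ge2 s : sound s -> 2 <= #|alive s|.
Proof. by move/kings_sub/subset_leq_card; rewrite cards2. Qed.

Lemma capture_count_le30 g : legal_sequence initial g -> capture_count g <= 30.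
Proof.
move=> hg; have := card_alive hg (leqnn (size g)).
by have := card_alive_ge2 (sound_position hg (leqnn (size g))); rewrite /capture_count /plies; lia.
Qed.

Lemma mem_critical_plies g t : (t \in critical_plies g) = (1 <= t <= size g) && critical g t.
Proof. by rewrite mem_filter andbC mem_iota add1n ltnS. Qed.

Lemma critical_plies_sorted g : sorted leq (critical_plies g).
Proof. by apply: sorted_filter; [apply: leq_trans | apply: iota_sorted]. Qed.

Lemma sorted_le_last s t : sorted leq s -> t \in s -> t <= last 0 s.
Proof.
case/lastP: s => // s y; rewrite sorted_pairwise; last exact: leq_trans.
rewrite pairwise_rcons last_rcons mem_rcons inE => /andP[/allP hs _].
by case/orP=> [/eqP->//|/hs].
Qed.

(** After the thirtieth capture only kings are left and the game is over, so
that capture is the last ply and no noncritical tail follows it. *)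
Lemma captures_and_tail g : is_game g -> capture_count g + tail g <= 30.
Proof.
case=> hg _ hn; have c30 := capture_count_le30 hg.
rewrite leq_eqVlt in c30; case/orP: c30 => [/eqP c30|]; last by case: tail => /=; lia.
rewrite c30 /tail.
suff -> : (critical_plies g == [::]) || (last 0 (critical_plies g) < size g) = false by [].
have ex : 0 < count (at_ply capture g) (plies g) by rewrite -/(capture_count g) c30.
pose P k := (k <= size g) && (count (at_ply capture g) (iota 1 k) == 30).
have exP : exists k, P k by exists (size g); rewrite /P leqnn -c30 /capture_count /plies eqxx.
(* k is the ply of the thirtieth capture. *)
have [k /andP[kn /eqP k30] kmin] := ex_minnP exP.
have kL : k = size g.
  apply/eqP; rewrite eqn_leq kn leqNgt; apply/negP=> lt; apply: (hn k lt).
  apply: Or42; apply: bare_kings_dead; first exact: sound_position.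
  by have := card_alive hg kn; rewrite k30; lia.
case: k => [|k] in kn k30 kmin kL *; first by rewrite /= in k30.
have cap : at_ply capture g k.+1.
  apply/negPn/negP=> /negPf nc; have /kmin : P k; last by rewrite ltnn.
  rewrite /P (ltnW kn) /=; move: k30; rewrite iota1S count_cat /= nc !addn0.
  by move=> ->.
have hin : k.+1 \in critical_plies g.
  by rewrite mem_critical_plies kn; apply/orP; right.
rewrite ltnNge -{1}kL sorted_le_last ?critical_plies_sorted // orbF.
by case: (critical_plies g) hin.
Qed.

(** Mapping a resolved pair to the first pawn capture by one of its members is
injective, since the capturing pawn determines the pair. *)
Lemma pawn_capture_count_ge g : resolved_count g <= pawn_capture_count g.
Proof.
pose own x t := at_ply pawn_capture g t &&
  ((at_ply moving_pawn g t == Some (White, inl x)) ||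
   (at_ply moving_pawn g t == Some (Black, inl x))).
pose h x := head 0 [seq t <- plies g | own x t].
have hP x : resolved g x ->
    h x \in [seq t <- plies g | at_ply pawn_capture g t] /\
    exists c, at_ply moving_pawn g (h x) = Some (c, inl x).
  move=> rx; have : h x \in [seq t <- plies g | own x t].
    have : has (own x) (plies g).
      case/orP: rx => /hasP[t tp /andP[m c]]; apply/hasP; exists t => //;
      rewrite /own m ?orbT andbT /at_ply /pawn_capture /pawn_move;
      by move: c m; rewrite /at_ply => -> /eqP->.
    by rewrite has_filter /h; case: (filter _ _) => //= t s _; rewrite mem_head.
  rewrite !mem_filter => /andP[/andP[-> mp] ->]; split=> //.
  by case/orP: mp => /eqP ->; eexists.
rewrite /resolved_count /pawn_capture_count -size_filter cardE -(size_map h).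
apply: uniq_leq_size => [|t /mapP[x]]; last by rewrite mem_enum inE => /hP[hx _] ->.
rewrite map_inj_in_uniq ?enum_uniq // => x y; rewrite !mem_enum !inE.
by move=> /hP[_ [c e]] /hP[_ [c' e']] exy; move: e; rewrite exy e' => -[_].
Qed.

Lemma count_sum_seq (T : Type) (a : pred T) s : count a s = \sum_(t <- s) a t.
Proof. by rewrite -sum1_count big_mkcond; apply: eq_bigr => t _; case: (a t). Qed.

Lemma moving_pawn_sum s m : sound s ->
  (pawn_move s m : nat) = \sum_(x < 8) ((moving_pawn s m == Some (White, inl x)) +
                              (moving_pawn s m == Some (Black, inl x))).
Proof.
move=> hs; rewrite /pawn_move; case mp: moving_pawn => [p|] /=; last by rewrite big1.
have [_ [_ [_ [_ _ kp]]]] := moving_pawnP mp.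
have [c [x ->]] := pawn_identity hs kp.
rewrite (bigD1 x) //= big1 => [|y yx]; first by case: c; rewrite !eqxx.
suff ne d : (Some (c, inl x : 'I_8 + 'I_8) == Some (d, inl y)) = false by rewrite !ne.
by apply/negP=> /eqP[_ xy]; rewrite xy eqxx in yx.
Qed.

Lemma pawn_move_count_sum g : legal_sequence initial g ->
  pawn_move_count g = \sum_(x < 8) (size (pawn_plies g (White, inl x)) +
                               size (pawn_plies g (Black, inl x))).
Proof.
move=> hg; rewrite /pawn_move_count count_sum_seq.
under [RHS]eq_bigr => x _ do rewrite !size_filter !count_sum_seq -big_split.
rewrite exchange_big; apply: eq_big_seq => -[|t]; rewrite mem_iota // => ht.
by apply: moving_pawn_sum; apply: sound_position; rewrite //=; lia.
Qed.

Lemma pawn_plies_le6 g c x : legal_sequence initial g ->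
  size (pawn_plies g (c, inl x)) <= 6.
Proof.
move=> hg; apply: leq_trans (size_pawn_plies_to c x hg (leqnn _)) _.
by have [] := pawn_location c x hg (leqnn _).
Qed.

(** Twelve moves per resolved pair and ten per unresolved pair. *)
Lemma pawn_move_count_le g : legal_sequence initial g ->
  pawn_move_count g <= 80 + 2 * resolved_count g.
Proof.
move=> hg; rewrite pawn_move_count_sum //.
have -> : 80 + 2 * resolved_count g = \sum_(x < 8) (10 + 2 * resolved g x).
  rewrite big_split /= sum_nat_const card_ord -big_distrr /=; congr (_ + 2 * _).
  rewrite /resolved_count cardsE -sum1_card big_mkcond; apply: eq_bigr => x _.
  by case: ifP => [h|h]; [have -> : resolved g x := h | have -> : resolved g x = false := h].
apply: leq_sum => x _.
have := pawn_plies_le6 White x hg; have := pawn_plies_le6 Black x hg.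
case rx: (resolved g x); first by lia.
move/negbT: rx; rewrite negb_or => /andP[nw nb] _ _.
by rewrite muln0 addn0; apply: (unresolved_moves (c := White) hg (leqnn _) nw nb).
Qed.

Lemma critical_count g :
  size (critical_plies g) + pawn_capture_count g = pawn_move_count g + capture_count g.
Proof. by rewrite size_filter /pawn_move_count /capture_count -count_predUI. Qed.

(** * Segments *)

Lemma size_endpoints g : size (endpoints g) = segment_count g.
Proof. by rewrite size_cat /segment_count; case: tail. Qed.

Lemma endpoints_sorted g : sorted leq (0 :: endpoints g).
Proof.
rewrite sorted_pairwise; last exact: leq_trans.
rewrite /= all_predT /= pairwise_cat -sorted_pairwise ?critical_plies_sorted; last exact: leq_trans.
case: tail; rewrite /= ?allrel0r // !andbT.
by apply/allrelP=> t u; rewrite mem_critical_plies inE => /andP[/andP[_ ht] _] /eqP->.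
Qed.

Lemma last_endpoints g : last 0 (endpoints g) = size g.
Proof.
rewrite last_cat; case e: tail => //=.
move/negbT: e; rewrite negb_or -leqNgt => /andP[ne le].
apply/eqP; rewrite eqn_leq le andbT.
have : last 0 (critical_plies g) \in critical_plies g.
  by case: (critical_plies g) ne => //= t s _; apply: mem_last.
by rewrite mem_critical_plies => /andP[/andP[]].
Qed.

Lemma endpoint_mono g i j : i <= j -> j <= segment_count g ->
  endpoint g i <= endpoint g j.
Proof.
move=> ij jK; apply: (sorted_leq_nth leq_trans leqnn 0 (endpoints_sorted g)) => //;
  rewrite inE /= size_endpoints ltnS //; exact: leq_trans jK.
Qed.

Lemma endpoint_last g : endpoint g (segment_count g) = size g.
Proof. by rewrite -last_endpoints /endpoint -size_endpoints; exact: nth_last. Qed.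

Lemma noncritical_between g i t : 0 < i <= segment_count g ->
  endpoint g i.-1 < t < endpoint g i -> ~~ critical g t.
Proof.
move=> /andP[i0 iK] /andP[h1 h2]; apply/negP=> ct.
have tc : t \in critical_plies g.
  have := endpoint_mono iK (leqnn _); rewrite endpoint_last mem_critical_plies ct andbT; lia.
have te : t \in endpoints g by rewrite mem_cat tc.
have et : endpoint g (index t (endpoints g)).+1 = t by rewrite /endpoint /= nth_index.
have jK : (index t (endpoints g)).+1 <= segment_count g by rewrite -size_endpoints index_mem.
have [h|h] := ltnP (index t (endpoints g)).+1 i.
  have le : (index t (endpoints g)).+1 <= i.-1 by lia.
  by have := @endpoint_mono g _ _ le; rewrite et; lia.
by have := @endpoint_mono g _ _ h jK; rewrite et; lia.
Qed.

(** A longer segment would contain 150 noncritical plies before its last ply,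
and the game would have ended there. *)
Lemma segment_length_le150 g i : is_game g -> 0 < i <= segment_count g ->
  endpoint g i <= endpoint g i.-1 + 150.
Proof.
move=> [hg _ hn] hi; rewrite leqNgt; apply/negP=> lt.
have le : endpoint g i <= size g by rewrite -endpoint_last endpoint_mono; case/andP: hi.
apply: (hn (endpoint g i.-1 + 150)); first exact: leq_trans le.
apply: Or44; split; first exact: leq_addl.
move=> t; rewrite addnK => ht; apply: noncritical_between hi _; lia.
Qed.

(** The shortfall as a natural number; [segment_balance] shows that neither
subtraction is truncated for a segment of a game. *)
Definition defect g i : nat :=
  150 - switches g i - (endpoint g i - endpoint g i.-1).

(** When the endpoints of a segment have different colours, its length is odd
and hence different from 150. *)
Lemma segment_balance g i : is_game g -> 0 < i <= segment_count g ->
  endpoint g i + switches g i + defect g i = endpoint g i.-1 + 150.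
Proof.
move=> hg hi; have h150 := segment_length_le150 hg hi.
have mono : endpoint g i.-1 <= endpoint g i by apply: endpoint_mono; lia.
suff : endpoint g i + switches g i <= endpoint g i.-1 + 150 by rewrite /defect; lia.
rewrite /switches /color_at; have [e|//] := eqVneq (endpoint g i) (endpoint g i.-1 + 150).
  by rewrite e oddD addbF eqxx addn0.
by move=> ne; apply: (@leq_trans (endpoint g i + 1)); [rewrite leq_add2l leq_b1 | lia].
Qed.

Lemma length_balance g n : is_game g -> n <= segment_count g ->
  endpoint g n + \sum_(1 <= i < n.+1) switches g i + \sum_(1 <= i < n.+1) defect g i
  = 150 * n.
Proof.
move=> hg; elim: n => [|n IH] hn; first by rewrite !big_geq.
rewrite big_nat_recr //= [X in _ + X]big_nat_recr //=.
by have := segment_balance (i := n.+1) hg hn; have := IH (ltnW hn); rewrite /=; lia.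
Qed.

Lemma shortfall_defect g i : is_game g -> 0 < i <= segment_count g ->
  shortfall g i = (defect g i)%:Z%R.
Proof.
move=> hg hi; have := segment_balance hg hi.
by rewrite /shortfall /max_length /segment_length; case: switches => /=; lia.
Qed.

(** * Block patterns *)

Lemma block_pattern_cons x y s : block_pattern (x :: y :: s) =
  if x == y then block_pattern (y :: s) else x :: block_pattern (y :: s).
Proof. by []. Qed.

(** Adjacent blocks have different colours and there are only two colours, so a
block pattern is determined by its first letter and its length. *)
Lemma block_pattern_traject x s :
  block_pattern (x :: s) = traject opp x (size (block_pattern (x :: s))).
Proof.
elim: s x => // y s IH x; rewrite block_pattern_cons.
case: eqP => [->|/eqP]; first exact: IH.
by rewrite neq_opp => /eqP->; rewrite /= oppK -IH.
Qed.

Lemma block_pattern_subseq s : subseq (block_pattern s) s.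
Proof.
elim: s => // x [|y s] IH; first by rewrite /= eqxx.
rewrite block_pattern_cons; case: ifP => _; last by rewrite /= eqxx.
exact: subseq_trans IH (subseq_cons _ _).
Qed.

(** Different letters of an alternating subsequence lie in different blocks; if
the subsequence does not start with the first letter of the sequence, it also
misses the first block. *)
Lemma size_block_pattern_ge n y x s : subseq (traject opp y n) (x :: s) ->
  n + (y != x) <= size (block_pattern (x :: s)).
Proof.
elim: s n x y => [|z s IH] [|n] x y.
- by case: eqP.
- by rewrite /=; case: (y =P x) => //= _; case: n.
- have := IH 0 z (opp z) (sub0seq _); rewrite block_pattern_cons opp_neq => h _.
  by case: (x == z); rewrite /= -/(block_pattern (z :: s)); case: (y != x); lia.
rewrite block_pattern_cons [subseq _ _]/= => h.
have -> : size (if x == z then block_pattern (z :: s) else x :: block_pattern (z :: s))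
  = (x != z) + size (block_pattern (z :: s)) by case: eqP.
move: h; case: (y =P x) => [->|ne] /= h.
  by have := IH _ _ _ h; case: x z {h IH} => [] [] /=; lia.
by have := IH n.+1 z y h; case: x y z ne {h IH} => [] [] [] //= _; lia.
Qed.

(** A sequence starting with White and containing BWB has at least four blocks,
hence five once Black is put in front; so the sequence starts with Black, and
containing WBW it then has at least four blocks. *)
Lemma alternation_BWBW s : size (block_pattern (Black :: s)) <= 4 ->
  subseq [:: White; Black; White] s -> subseq [:: Black; White; Black] s ->
  block_pattern s = [:: Black; White; Black; White] /\
  size (block_pattern (Black :: s)) = 4.
Proof.
case: s => // x s h4 hw hb.
have gw := size_block_pattern_ge (n := 3) (y := White) hw.
have gb := size_block_pattern_ge (n := 3) (y := Black) hb.
move: h4; rewrite block_pattern_cons; case: x gw gb {hw hb} => gw gb.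
  by move: gb; rewrite /= -/(block_pattern (White :: s)); lia.
rewrite eqxx => h4; have e4 : size (block_pattern (Black :: s)) = 4.
  by apply/eqP; rewrite eqn_leq h4.
by rewrite {1}block_pattern_traject e4.
Qed.

Lemma size_block_pattern_sum e0 es :
  size (block_pattern [seq color_at e | e <- e0 :: es]) =
  (\sum_(1 <= i < (size es).+1)
     (color_at (nth 0 (e0 :: es) i) != color_at (nth 0 (e0 :: es) i.-1))).+1.
Proof.
elim: es e0 => [|e es IH] e0; first by rewrite big_geq.
rewrite map_cons [map _ _]/= block_pattern_cons.
have -> (b : bool) (c : color) u : size (if b then u else c :: u) = size u + ~~ b.
  by case: b; rewrite ?addn0 ?addn1.
rewrite -map_cons IH [in RHS]big_nat_recl //= addSn addnC eq_sym; congr (_ + _).+1.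
by apply: eq_big_nat => -[|i].
Qed.

Lemma switch_count_pattern g : (switch_count g).+1 =
  size (block_pattern (Black :: [seq color_at e | e <- endpoints g])).
Proof. by rewrite -[Black]/(color_at 0) -map_cons size_block_pattern_sum size_endpoints. Qed.

(** * Alternation of critical moves *)

Lemma pawn_plies_split g p t : t \in pawn_plies g p ->
  exists r, pawn_plies g p = pawn_plies_to g p t.-1 ++ t :: r.
Proof.
rewrite mem_filter mem_iota add1n ltnS => /and3P[mp t0 tn].
exists [seq t <- iota t.+1 (size g - t) | at_ply moving_pawn g t == Some p].
rewrite /pawn_plies /pawn_plies_to /plies.
have -> : size g = t.-1 + (1 + (size g - t)) by lia.
have e : 1 + t.-1 = t by lia.
rewrite iotaD filter_cat e iotaD filter_cat /= mp addn1.
by have -> : t.-1 + (1 + (size g - t)) - t = size g - t by lia.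
Qed.

Lemma pawn_plies_uniq g p : uniq (pawn_plies g p).
Proof. by rewrite filter_uniq ?iota_uniq. Qed.

Lemma index_pawn_plies g p t : t \in pawn_plies g p ->
  index t (pawn_plies g p) = size (pawn_plies_to g p t.-1).
Proof.
move=> tp; have [r e] := pawn_plies_split tp.
have := pawn_plies_uniq g p; rewrite e cat_uniq => /and3P[_ /hasPn h _].
by rewrite index_cat (negPf (h t (mem_head _ _))) /= eqxx addn0.
Qed.

Lemma pawn_plies_ply g p t : t \in pawn_plies g p ->
  [/\ 0 < t <= size g, moving_pawn (position g t.-1) (ply g t) = Some p & critical g t].
Proof.
rewrite mem_filter mem_iota add1n ltnS => /andP[/eqP mp ->]; split=> //.
by rewrite /critical /at_ply /critical_move /pawn_move -/(at_ply moving_pawn g t) mp.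
Qed.

Lemma pawn_ply_color g p t : legal_sequence initial g -> t \in pawn_plies g p ->
  color_at t = p.1.
Proof.
move=> hg /pawn_plies_ply[ht mp _]; have tn : t.-1 < size g by lia.
have := legal_ply hg tn; have tS : t.-1.+1 = t by lia.
by rewrite tS => hl; rewrite (moving_pawn_turn hl mp) turn_position ?tS // ltnW.
Qed.

Lemma active_pawn_earlier g p k k' : legal_sequence initial g -> k <= k' <= size g ->
  active_pawn (position g k') p -> active_pawn (position g k) p.
Proof.
move=> hg /andP[/subnKC<-]; elim: (k' - k) => [|d IH]; first by rewrite addn0.
rewrite addnS => hk; rewrite positionS // => h; apply: IH; first exact: ltnW.
by apply: active_pawn_do_move h; [apply: sound_position => //; apply: ltnW | apply: legal_ply].
Qed.

(** A piece that disappears is captured by the opponent of its owner. *)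
Lemma captured_later g p k : legal_sequence initial g -> k <= size g ->
  p \in alive (position g k) -> p \notin alive (position g (size g)) ->
  exists t, [/\ k < t <= size g, critical g t & color_at t = opp p.1].
Proof.
move=> hg hk pk pn.
pose Q j := (k <= j <= size g) && (p \notin alive (position g j)).
have exQ : exists j, Q j by exists (size g); rewrite /Q hk leqnn.
have [[|j] /andP[/andP[kj jn] pj] jmin] := ex_minnP exQ.
  by move: kj pk; rewrite leqn0 => /eqP->; rewrite (negPf pj).
have {}kj : k <= j.
  by move: kj; rewrite leq_eqVlt => /orP[/eqP kj|//]; rewrite -kj pk in pj.
have pj' : p \in alive (position g j).
  by apply: contraT => np; have := jmin j; rewrite /Q kj ltnW //= np ltnn => /(_ isT).
have hs := sound_position hg (ltnW jn); have hl := legal_ply hg jn.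
exists j.+1; move: pj; rewrite positionS // alive_do_move // in_setD pj' andbT [X in ~~ ~~ X]in_set.
move/negPn/eqP=> vi; have [_ cp _] := victimP hs hl vi.
split; first by rewrite ltnS kj.
  by rewrite /critical /at_ply /critical_move capture_victim // vi orbT.
have jle : j <= size g by apply: ltnW.
rewrite -(turn_position jle).
by apply/eqP; rewrite -neq_opp eq_sym.
Qed.

(** Five earlier moves have climbed at least five ranks, and a pawn is never on
the last rank; so the sixth move starts one rank below promotion. *)
Lemma sixth_pawn_ply g c x (p := (c, inl x)) (t := nth 0 (pawn_plies g p) 5) :
  legal_sequence initial g -> size (pawn_plies g p) = 6 ->
  t \in pawn_plies g p /\
  exists a b k, [/\ ply g t = Shift a b k, board (position g t.-1) a = Some p,
    rank_for c a = 6, board (position g t) b = Some p & k != None].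
Proof.
move=> hg h6; have tp : t \in pawn_plies g p by rewrite mem_nth ?h6.
split=> //; have it : size (pawn_plies_to g p t.-1) = 5.
  by rewrite -index_pawn_plies // index_uniq ?pawn_plies_uniq ?h6.
have [ht mp _] := pawn_plies_ply tp; have tS : t = t.-1.+1 by lia.
have tn : t.-1 < size g by lia.
have hs := sound_position hg (ltnW tn); have hl := legal_ply hg tn.
rewrite -tS in hl; have [a [b [k [em ba kp pr [bb pk]]]]] := legal_pawn_move hs hl mp.
have [_ /(_ a ba kp)[ra r7 _]] := pawn_location c x hg (ltnW tn).
have := size_pawn_plies_to c x hg (ltnW tn); rewrite -/p it => ad.
have [rb rd _ _] := pawn_reachesP ba kp pr.
have ra7 := rank_for_le7 c a; have rb7 := rank_for_le7 c b.
rewrite -/p in ra; have ra6 : rank_for c a = 6 by lia.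
exists a, b, k; split=> //.
  by rewrite tS positionS // -tS.
by case: pk => [[_ [? _]]//|[[]]]; rewrite /= in rb *; lia.
Qed.

(** Six moves of at least one rank each share a total climb of at most six. *)
Lemma one_rank_plies g c x (p := (c, inl x)) :
  legal_sequence initial g -> size (pawn_plies g p) = 6 ->
  all (fun t => one_rank (ply g t)) (pawn_plies g p).
Proof.
move=> hg h6; apply/allP=> t tp.
have rises u : u \in pawn_plies g p -> 0 < rise (ply g u).
  move=> /pawn_plies_ply[hu mp _]; have tn : u.-1 < size g by lia.
  have hs := sound_position hg (ltnW tn); have hl := legal_ply hg tn.
  rewrite prednK in hl; last by lia.
  have [a [b [k [em ba kp pr _]]]] := legal_pawn_move hs hl mp.
  by have [_ rd _ _] := pawn_reachesP ba kp pr; rewrite em.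
have [a6 _] := pawn_location c x hg (leqnn (size g)).
have : \sum_(u <- pawn_plies g p) 1 + (rise (ply g t)).-1 <= 6.
  apply: leq_trans a6; rewrite /advance (big_rem t) //= [X in _ <= X](big_rem t) //=.
  rewrite addnAC leq_add //; first by have := rises t tp; lia.
  rewrite big_seq [X in _ <= X]big_seq; apply: leq_sum => u /mem_rem; exact: rises.
rewrite sum1_size h6; have := rises t tp.
by rewrite /rise; case: (ply g t) => //= a b _ r0 r1; apply/eqP; lia.
Qed.

(** Otherwise the opposing pawn that began on the file where the promotion move
starts would still be at home, since it has moves left to make; but its home
square is where the promoting pawn stands. *)
Lemma opponent_moves_before_promotion g c x (t := nth 0 (pawn_plies g (c, inl x)) 5) :
  legal_sequence initial g -> (forall d y, size (pawn_plies g (d, inl y)) = 6) ->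
  exists u, [/\ 0 < u < t, critical g u & color_at u = opp c].
Proof.
move=> hg h6; have [tp [a [b [k [em ba ra _ _]]]]] := sixth_pawn_ply hg (h6 c x).
rewrite -/t in tp ba; have [ht _ _] := pawn_plies_ply tp.
pose p' : piece := (opp c, inl a.1).
case e : (pawn_plies_to g p' t.-1) => [|u s]; last first.
  have up : u \in pawn_plies_to g p' t.-1 by rewrite e mem_head.
  have ug : u \in pawn_plies g p'.
    by move: up; rewrite !mem_filter !mem_iota => /and3P[-> -> ?] /=; lia.
  have [hu _ cu] := pawn_plies_ply ug; exists u; split=> //.
    by move: up; rewrite mem_filter mem_iota; lia.
  exact: pawn_ply_color ug.
have [v vp] : exists v, v \in pawn_plies g p'.
  by exists (nth 0 (pawn_plies g p') 0); rewrite mem_nth ?h6.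
have [hv mv _] := pawn_plies_ply vp.
have tv : t <= v.
  rewrite leqNgt; apply/negP=> vt.
  have : v \in pawn_plies_to g p' t.-1.
    by move: vp; rewrite !mem_filter !mem_iota => /and3P[-> -> ?] /=; lia.
  by rewrite e.
have act : active_pawn (position g t.-1) p'.
  by apply: active_pawn_earlier (moving_pawn_is_active mv) => //; lia.
have /active_pawnP[q [bq kq]] := act.
have hk : t.-1 <= size g by lia.
have [_ /(_ q bq kq)[rq _ fq]] := pawn_location (opp c) a.1 hg hk.
have nc : ~~ captures_as_pawn_to g p' t.-1.
  apply/hasPn=> w wi; rewrite negb_and; apply/orP; left; apply/negP=> mw.
  have : w \in pawn_plies_to g p' t.-1 by rewrite mem_filter mw wi.
  by rewrite e.
move: rq; rewrite /advance -/p' e big_nil => rq.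
have qa : q = a.
  by apply: (rank_for_inj (c := opp c)); [exact: fq | rewrite rq rank_for_opp ra].
by move: bq; rewrite qa ba => -[] ; case: (c).
Qed.

Lemma critical_subseq g t1 t2 t3 : critical g t1 -> critical g t2 -> critical g t3 ->
  0 < t1 -> t1 < t2 -> t2 < t3 -> t3 <= size g ->
  subseq [:: t1; t2; t3] (critical_plies g).
Proof.
move=> c1 c2 c3 h0 h12 h23 h3.
suff -> : [:: t1; t2; t3] = [seq t <- critical_plies g | t \in [:: t1; t2; t3]].
  exact: filter_subseq.
apply: (irr_sorted_eq ltn_trans ltnn).
- by rewrite /= h12 h23.
- by apply: sorted_filter; [apply: ltn_trans | apply: sorted_filter;
    [apply: ltn_trans | apply: iota_ltn_sorted]].
move=> t; rewrite mem_filter mem_critical_plies; case: (boolP (t \in _)) => //.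
by rewrite !inE => /or3P[]/eqP->; rewrite ?c1 ?c2 ?c3 andbT; lia.
Qed.

(** With at most three survivors, two of them kings, some pawn of [c] is
captured. As it makes six pawn moves, it is captured after its promotion, by a
critical move of the opponent; the promotion is the critical move of [c] in
the middle. *)
Lemma critical_alternation g c : legal_sequence initial g ->
  (forall d y, size (pawn_plies g (d, inl y)) = 6) -> 29 <= capture_count g ->
  subseq [:: opp c; c; opp c] [seq color_at t | t <- critical_plies g].
Proof.
move=> hg h6 h29.
have [x nx] : exists x, (c, inl x) \notin alive (position g (size g)).
  apply/existsP; rewrite -negb_forall; apply/negP=> /forallP h.
  (* Two surviving pawns and the kings would make four survivors. *)
  have : king White |: (king Black |: [set (c, inl (ord8 0)); (c, inl (ord8 1))])
      \subset alive (position g (size g)).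
    have hs := sound_position hg (leqnn (size g)).
    apply/subsetP=> p; rewrite !in_setU !in_set1 => /or4P[]/eqP->.
    - exact: king_alive.
    - exact: king_alive.
    - exact: h.
    - exact: h.
  move/subset_leq_card; rewrite !cardsU1 cards1 !in_setU !in_set1 => h4.
  have {}h4 : 4 <= #|alive (position g (size g))| by apply: leq_trans h4; case: (c).
  by have := card_alive hg (leqnn (size g)); move: h29; rewrite /capture_count /plies; lia.
set t := nth 0 (pawn_plies g (c, inl x)) 5.
have [tp [a [b [k [em ba _ bb _]]]]] := sixth_pawn_ply hg (h6 c x).
have [ht _ ct] := pawn_plies_ply tp.
have [u [hu cu colu]] := @opponent_moves_before_promotion g c x hg h6.
have pa : (c, inl x) \in alive (position g t) by apply/aliveP; exists b.
have [v [hv cv colv]] := captured_later hg (proj2 (andP ht)) pa nx.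
have := critical_subseq cu ct cv.
have -> : [:: opp c; c; opp c] = [seq color_at i | i <- [:: u; t; v]].
  by rewrite /= colu colv (pawn_ply_color hg tp).
by move=> h; apply/map_subseq/h; lia.
Qed.

(** * Games of length 17697 *)

Lemma segment_count_balance g :
  segment_count g + pawn_capture_count g =
  pawn_move_count g + (capture_count g + tail g).
Proof. by rewrite /segment_count addnAC critical_count addnA. Qed.

Lemma resolved_count_le8 g : resolved_count g <= 8.
Proof. by rewrite -[X in _ <= X]card_ord; apply: max_card. Qed.

Lemma segment_count_le118 g : is_game g -> segment_count g <= 118.
Proof.
move=> hg; have [hl _ _] := hg.
have := segment_count_balance g; have := pawn_move_count_le hl.
have := pawn_capture_count_ge g; have := captures_and_tail hg.
have := resolved_count_le8 g; lia.
Qed.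

Lemma six_moves_each g : legal_sequence initial g -> pawn_move_count g = 96 ->
  forall c x, size (pawn_plies g (c, inl x)) = 6.
Proof.
move=> hg h96 c x; apply/eqP; rewrite eqn_leq pawn_plies_le6 //= leqNgt; apply/negP=> lt.
have : pawn_move_count g <= 95; last by rewrite h96.
(* The pair of the deficient pawn makes at most 11 moves, the others 7 * 12. *)
rewrite pawn_move_count_sum // (bigD1 x) //=; apply: (@leq_add _ _ 11 84).
  have := pawn_plies_le6 White x hg; have := pawn_plies_le6 Black x hg.
  by case: c lt; lia.
apply: (@leq_trans (\sum_(y < 8 | y != x) 12)).
  by apply: leq_sum => y _; apply: (@leq_add _ _ 6 6); apply: pawn_plies_le6.
rewrite sum_nat_const; suff -> : #|[pred y : 'I_8 | y != x]| = 7 by [].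
by rewrite cardC1 card_ord.
Qed.

Theorem corollary5p2 (g : seq move) (hg : is_game g) (hL : size g = 17697) :
  [/\ segment_count g = 118, switch_count g = 3
    & forall i, 1 <= i <= 118 -> shortfall g i = 0%R] /\
  [/\ resolved_count g = 8, pawn_move_count g = 96, pawn_capture_count g = 8
    & capture_count g + tail g = 30] /\
  (forall (c : color) (x : 'I_8),
     let ts := pawn_plies g (c, inl x) in
     [/\ size ts = 6, all (fun t => one_rank (ply g t)) ts
       & promotion (ply g (nth 0 ts 5))]) /\
  29 <= capture_count g /\
  (forall i, 1 <= i <= segment_count g ->
     segment_length g i =
       (if color_at (endpoint g i) == color_at (endpoint g i.-1) then 150 else 149)%R) /\
  block_pattern [seq color_at t | t <- critical_plies g]
    = [:: Black; White; Black; White] /\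
  block_pattern [seq color_at e | e <- endpoints g]
    = [:: Black; White; Black; White].
Proof.
have [hl _ _] := hg.
have bal := length_balance hg (leqnn (segment_count g)).
(* 117 segments fall short of this length by 147 plies. *)
have L_eq : 17697 = 150 * 117 + 147 by [].
rewrite endpoint_last hL L_eq -/(switch_count g) in bal; clear L_eq hL.
have K118 : segment_count g = 118.
  by have := segment_count_le118 hg; move: bal; lia.
rewrite K118 in bal.
have [f8 P96 [C8 C30]] : [/\ resolved_count g = 8, pawn_move_count g = 96 &
    pawn_capture_count g = 8 /\ capture_count g + tail g = 30].
  have := segment_count_balance g; have := pawn_move_count_le hl.
  have := pawn_capture_count_ge g; have := captures_and_tail hg.
  by have := resolved_count_le8 g; rewrite K118; split; lia.
have h6 := six_moves_each hl P96.
have h29 : 29 <= capture_count g by move: C30; case: tail => /=; lia.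
have cpre : subseq [seq color_at t | t <- critical_plies g] [seq color_at e | e <- endpoints g].
  by rewrite /endpoints map_cat prefix_subseq.
have wbw := critical_alternation Black hl h6 h29.
have bwb := critical_alternation White hl h6 h29.
have S4 : size (block_pattern (Black :: [seq color_at e | e <- endpoints g])) <= 4.
  by rewrite -switch_count_pattern; move: bal; lia.
have [eB eS] := alternation_BWBW S4 (subseq_trans wbw cpre) (subseq_trans bwb cpre).
have [cB _] : block_pattern [seq color_at t | t <- critical_plies g]
    = [:: Black; White; Black; White] /\
   size (block_pattern (Black :: [seq color_at t | t <- critical_plies g])) = 4.
  apply: alternation_BWBW => //; apply: leq_trans S4.
  have sub : subseq (block_pattern (Black :: [seq color_at t | t <- critical_plies g]))
     (Black :: [seq color_at e | e <- endpoints g]).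
    by apply: subseq_trans (block_pattern_subseq _) _.
  rewrite block_pattern_traject in sub.
  by have := size_block_pattern_ge sub; rewrite eqxx addn0.
have S3 : switch_count g = 3.
  by apply/eqP; rewrite -eqSS switch_count_pattern eS.
have d0 i : 1 <= i <= 118 -> shortfall g i = 0%R.
  move=> hi; rewrite shortfall_defect ?K118 //.
  have /eqP : \sum_(1 <= j < 119) defect g j = 0 by move: bal; lia.
  rewrite sum_nat_seq_eq0 => /allP/(_ i); rewrite mem_index_iota.
  by move=> /(_ hi)/eqP->.
split; [by []|split; [by []|split; [|split; [by []|split; [|by []]]]]].
- move=> c x ts; split; [exact: h6 | exact: one_rank_plies|].
  have [_ [a [b [k [em _ _ _ nk]]]]] := sixth_pawn_ply hl (h6 c x).
  by rewrite em.
- move=> i; rewrite K118 => /d0; rewrite /shortfall /max_length /switches.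
  by case: eqP => _ /=; lia.
Qed.
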